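(* Let $I,J$ be positive integers and let $\mathcal{A}\in\mathbb{R}^{I\times J\times I\times J}$. Then there exist orthogonal tensors $\mathcal{U},\mathcal{V}\in\mathbb{R}^{I\times J\times I\times J}$ and a diagonal tensor $\mathcal{D}\in\mathbb{R}^{I\times J\times I\times J}$, with diagonal entries $\sigma_{ijij}$ (called singular values), such that $$\mathcal{A}=\mathcal{U}\ast_2\mathcal{D}\ast_2\mathcal{V}^T .$$ Moreover, this decomposition can be written as $$\mathcal{A}=\sum_{k=1}^{I}\sum_{l=1}^{J}\sigma_{klkl}\,\mathbf{U}_{kl}^{(3,4)}\circ\mathbf{V}_{kl}^{(3,4)},$$ a sum of fourth order tensors; that is, for all $i,j,\hat i,\hat j$, $a_{ij\hat i\hat j}=\sum_{k,l}\sigma_{klkl}\,(\mathbf{U}_{kl}^{(3,4)})_{ij}(\mathbf{V}_{kl}^{(3,4)})_{\hat i\hat j}$.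
   Context: For $\mathcal{S},\mathcal{T}\in\mathbb{R}^{I\times J\times I\times J}$ the Einstein product is $(\mathcal{T}\ast_2\mathcal{S})_{ij\hat i\hat j}=\sum_{u=1}^{I}\sum_{v=1}^{J}t_{ijuv}s_{uv\hat i\hat j}$. The transpose is $(\mathcal{S}^T)_{ijkl}=s_{klij}$. The identity tensor $\mathcal{I}$ has entries $\delta_{ik}\delta_{jl}$ in position $(i,j,k,l)$. A tensor $\mathcal{U}$ is orthogonal if $\mathcal{U}^T\ast_2\mathcal{U}=\mathcal{I}$. A tensor $\mathcal{D}$ is diagonal if $d_{ijkl}=0$ unless $i=k$ and $j=l$. For $\mathcal{U}\in\mathbb{R}^{I\times J\times I\times J}$, the matrix slice $\mathbf{U}_{kl}^{(3,4)}\in\mathbb{R}^{I\times J}$ is obtained by fixing the last two indices: $(\mathbf{U}_{kl}^{(3,4)})_{ij}=u_{ijkl}$. The outer product of matrices $\mathbf{B},\mathbf{C}$ is $(\mathbf{B}\circ\mathbf{C})_{ijkl}=b_{ij}c_{kl}$. *)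

(* Defs.v *)
From mathcomp Require Import all_boot all_order all_algebra.
From mathcomp Require Import reals.

Set Implicit Arguments.
Unset Strict Implicit.
Unset Printing Implicit Defensive.

Import GRing.Theory.
Local Open Scope ring_scope.

(* Entries are taken in R^o, i.e. R seen as a module over itself, so that the
   finite functions below carry the pointwise addition and scaling. *)
Definition tensor4 (R : nzRingType) (I J : nat) :=
  {ffun 'I_I * 'I_J * 'I_I * 'I_J -> R^o}.

Section Tensor4.
Variables (R : nzRingType) (I J : nat).

Implicit Types S T U D : tensor4 R I J.

Definition einstein2 T S : tensor4 R I J :=
  [ffun p : 'I_I * 'I_J * 'I_I * 'I_J =>
     let: (i, j, i', j') := p in
     \sum_(u < I) \sum_(v < J) (T (i, j, u, v) * S (u, v, i', j') : R)].

Definition trtensor S : tensor4 R I J :=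
  [ffun p : 'I_I * 'I_J * 'I_I * 'I_J =>
     let: (i, j, k, l) := p in S (k, l, i, j)].

Definition idtensor : tensor4 R I J :=
  [ffun p : 'I_I * 'I_J * 'I_I * 'I_J =>
     let: (i, j, k, l) := p in (i == k)%:R * (j == l)%:R : R].

Definition orthogonal_tensor U : Prop :=
  einstein2 (trtensor U) U = idtensor.

Definition diagonal_tensor D : Prop :=
  forall (i k : 'I_I) (j l : 'I_J), ~ (i = k /\ j = l) -> D (i, j, k, l) = 0.

Definition slice34 U (k : 'I_I) (l : 'I_J) : 'M[R]_(I, J) :=
  \matrix_(i < I, j < J) U (i, j, k, l).

Definition outer_mx (B C : 'M[R]_(I, J)) : tensor4 R I J :=
  [ffun p : 'I_I * 'I_J * 'I_I * 'I_J =>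
     let: (i, j, k, l) := p in B i j * C k l : R].

End Tensor4.

Notation "T *2 S" := (einstein2 T S)
  (at level 40, left associativity) : ring_scope.
Notation "S ^T4" := (trtensor S)
  (at level 8, format "S ^T4") : ring_scope.

(* Main.v *)
(* Grouping the index pairs (i, j) turns the Einstein product into a matrix
   product, so the theorem is the real singular value decomposition of a square
   matrix A.  A unit eigenvector v of the symmetric matrix A A^T yields a unit
   vector u and a scalar s with v A = s u and u A^T = s v; Householder
   reflections taking the first basis vector to v and to u reduce A to the block
   form diag(s, A'), and one concludes by induction on the size. *)
Require Import Defs.
From mathcomp Require Import all_boot all_order all_algebra.
From mathcomp Require Import reals.
From mathcomp Require Import complex.

Set Implicit Arguments.
Unset Strict Implicit.
Unset Printing Implicit Defensive.

Import GRing.Theory.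
Local Open Scope ring_scope.

Import Order.TTheory Num.Theory.

(** Inner products of row vectors appear as 1 by 1 matrices [v *m w^T]; this turns their equality
    into a scalar one. *)
Lemma mx11_inj (R : nmodType) (A B : 'M[R]_1) : A 0 0 = B 0 0 -> A = B.
Proof. by move=> eqAB; apply/matrixP=> i j; rewrite !ord1. Qed.

Lemma row_sqr_gt0 (R : realFieldType) n (v : 'rV[R]_n) :
  v != 0 -> 0 < (v *m v^T) 0 0.
Proof.
move=> v0; have [j vj] : exists j, v 0 j != 0 by apply/rV0Pn.
rewrite mxE (bigD1 j) //= mxE -expr2 ltr_pwDl ?exprn_even_gt0 //.
by apply: sumr_ge0 => i _; rewrite mxE -expr2 sqr_ge0.
Qed.

Lemma row_conj_sqr_gt0 (C : numClosedFieldType) n (v : 'rV[C]_n) :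
  v != 0 -> 0 < (v *m (map_mx Num.conj v)^T) 0 0.
Proof.
move=> v0; have [j vj] : exists j, v 0 j != 0 by apply/rV0Pn.
rewrite mxE (bigD1 j) //= !mxE -normCK ltr_pwDl ?exprn_gt0 ?normr_gt0 //.
by apply: sumr_ge0 => i _; rewrite !mxE -normCK exprn_ge0.
Qed.

Lemma unit_scaling (R : rcfType) n (v : 'rV[R]_n) : v != 0 ->
  exists2 c : R, c != 0 & (c *: v) *m (c *: v)^T = 1%:M.
Proof.
move=> v0; have q_gt0 := row_sqr_gt0 v0.
set q := _ 0 0 in q_gt0; exists (Num.sqrt q)^-1.
  by rewrite invr_eq0 gt_eqF // sqrtr_gt0.
apply: mx11_inj; rewrite linearZ /= -scalemxAl -scalemxAr scalerA.
rewrite !mxE eqxx -[X in _ * X]/(\sum_j v 0 j * v^T j 0).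
have -> : \sum_j v 0 j * v^T j 0 = q by rewrite /q mxE.
by rewrite -invfM -expr2 sqr_sqrtr ?ltW // mulVf // gt_eqF.
Qed.

(** An eigenvalue [a] exists over the complex extension of [R]. With [w] the conjugate of an
    eigenvector [v], evaluating [v *m S' *m w^T] from either side gives [a] and its conjugate as
    factors of the positive number [v *m w^T], so [a] is real. *)
Lemma symmetric_eigenvalue (R : rcfType) n (S : 'M[R]_n.+1) :
  S^T = S -> exists a, eigenvalue S a.
Proof.
move=> symS; pose S' := map_mx (real_complex R) S.
have [a /[dup] eig_a /eigenvalueP[v va v0]] := eigenvalue_closed S' (ltn0Sn n).
suff /complex_realP[b ab] : a \is Num.real.
  by exists b; rewrite -(eigenvalue_map (real_complex R)) -[_ b]ab.
pose w := map_mx Num.conj v.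
have S'_conj : map_mx Num.conj S' = S'.
  apply/matrixP=> i j; rewrite !mxE; apply/eqP; rewrite -CrealE.
  by apply/complex_realP; exists (S i j).
have wa : w *m S' = a^* *: w by rewrite -{1}S'_conj -map_mxM va map_mxZ.
have S'T : S'^T = S' by rewrite map_trmx symS.
have : v *m S' *m w^T = v *m (w *m S')^T by rewrite trmx_mul S'T mulmxA.
rewrite va wa linearZ /= -scalemxAl -scalemxAr => /matrixP/(_ 0 0).
rewrite !mxE -[\sum_j _]/(\sum_j v 0 j * w^T j 0) => eq_a.
have := row_conj_sqr_gt0 v0; rewrite -/w mxE => /lt0r_neq0 nz.
by rewrite CrealE; apply/eqP/(mulIf nz).
Qed.

(** Take [v] a unit eigenvector of [A *m A^T]. If [v *m A] is nonzero, [u] is its normalization and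
    [s] the inverse of the normalizing factor. Otherwise [A] is singular, and a unit [u] killed by
    [A^T] works with [s = 0]. *)
Lemma unit_singular_pair (R : rcfType) n (A : 'M[R]_n.+1) :
  exists (u v : 'rV[R]_n.+1) (s : R),
    [/\ u *m u^T = 1%:M, v *m v^T = 1%:M, v *m A = s *: u & u *m A^T = s *: v].
Proof.
have [|a /eigenvalueP[v0 v0a nz_v0]] := @symmetric_eigenvalue R n (A *m A^T).
  by rewrite trmx_mul trmxK.
have [c _ v1] := unit_scaling nz_v0; set v := c *: v0 in v1.
have va : v *m A *m A^T = a *: v.
  by rewrite -mulmxA /v -scalemxAl v0a !scalerA mulrC.
clearbody v.
have [vA0|nz_vA] := eqVneq (v *m A) 0.
  have detA0 : \det A^T == 0.
    rewrite det_tr; apply/det0P; exists v => //.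
    apply: contra_eq_neq v1 => ->; rewrite mul0mx eq_sym; exact: oner_neq0.
  have /det0P[u0 nz_u0 u0A] := detA0; have [d _ u1] := unit_scaling nz_u0.
  exists (d *: u0), v, 0; split=> //; first by rewrite vA0 scale0r.
  by rewrite -scalemxAl u0A scaler0 scale0r.
have [d nz_d u1] := unit_scaling nz_vA.
exists (d *: (v *m A)), v, d^-1; split=> //.
  by rewrite scalerA mulVf ?scale1r.
(* This is [u *m u^T = 1%:M] expanded with [v *m A *m A^T = a *: v]; it gives [d * a = d^-1], the
   required [s]. *)
have : d * d * a = 1.
  move: u1; rewrite linearZ /= trmx_mul -scalemxAl -scalemxAr scalerA.
  rewrite mulmxA va -scalemxAl v1 scalerA => /matrixP/(_ 0 0).
  by rewrite !mxE eqxx mulr1.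
rewrite -scalemxAl va scalerA => dda; congr (_ *: _).
by apply: (mulfI nz_d); rewrite mulfV // mulrA.
Qed.

(** For [e != v], the reflection in the hyperplane orthogonal to [e - v] exchanges [e] and [v],
    which have equal length. *)
Lemma householder (R : realFieldType) n (e v : 'rV[R]_n) :
    e *m e^T = 1%:M -> v *m v^T = 1%:M ->
  exists2 H : 'M[R]_n, H *m H^T = 1%:M & e *m H = v.
Proof.
move=> e1 v1; have [<-|nz_w] := eqVneq e v.
  by exists 1%:M; rewrite ?trmx1 ?mulmx1.
pose w := e - v; have : w != 0 by rewrite subr_eq0.
move/row_sqr_gt0/lt0r_neq0; set q := _ 0 0 => nz_q.
have wq : w *m w^T = q%:M by apply: mx11_inj; rewrite [RHS]mxE.
have ve : v *m e^T = e *m v^T.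
  by apply: mx11_inj; rewrite -[v in LHS]trmxK -trmx_mul mxE.
(* Since [e] and [v] are unit vectors, both sides equal [2 - 2 e v^T]. Hence the reflection
   subtracts exactly [w] from [e]. *)
have ew : 2 *: (e *m w^T) = q%:M.
  rewrite -wq /w linearB /= !mulmxBr !mulmxBl e1 v1 ve.
  by rewrite mulr2n scalerDl scale1r opprB.
have ewv : e - w = v by rewrite opprB addrC subrK.
clearbody q w; exists (1%:M - (2 / q) *: (w^T *m w)).
  rewrite linearB /= trmx1 [(_ *: _)^T]linearZ /= trmx_mul trmxK.
  rewrite mulmxBr mulmx1 mulmxBl mul1mx -scalemxAl -scalemxAr scalerA.
  rewrite -[w^T *m w *m _]mulmxA [w *m (_ *m _)]mulmxA wq mul_scalar_mx.
  rewrite -scalemxAr scalerA -mulrA divfK // -addrA -opprD -scalerBl.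
  rewrite mulr2n mulrDr mulr1 [- (_ / _ + _)]opprD addrA.
  by rewrite subrr sub0r scaleNr subrr subr0.
rewrite mulmxBr mulmx1 -scalemxAr mulmxA mulrC -scalerA scalemxAl ew.
by rewrite mul_scalar_mx scalerA mulVf // scale1r.
Qed.

Lemma orthogonal_block (R : comNzRingType) n (U : 'M[R]_n) :
  U^T *m U = 1%:M ->
  (block_mx (1%:M : 'M_1) 0 0 U)^T *m block_mx 1%:M 0 0 U = 1%:M.
Proof.
move=> U1; rewrite tr_block_mx mulmx_block !trmx0 trmx1.
by rewrite !mulmx0 !mul0mx mul1mx !addr0 !add0r U1 -scalar_mx_block.
Qed.

Lemma svd_mx (R : rcfType) n (A : 'M[R]_n) :
  exists (U V : 'M[R]_n) (d : 'rV[R]_n),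
    [/\ U^T *m U = 1%:M, V^T *m V = 1%:M & A = U *m diag_mx d *m V^T].
Proof.
elim: n => [|n IHn] in A *.
  by exists 1%:M, 1%:M, 0; split; apply/matrixP => -[].
rewrite -[n.+1]/(1 + n)%N in A *.
have [u [v [s [u1 v1 vA uA]]]] := unit_singular_pair A.
pose e : 'rV[R]_(1 + n) := row_mx 1%:M 0.
have e1 : e *m e^T = 1%:M.
  by rewrite tr_row_mx mul_row_col mul0mx addr0 trmx1 mulmx1.
have [H H1 eH] := householder e1 v1; have [K K1 eK] := householder e1 u1.
pose B : 'M[R]_(1 + n) := H *m A *m K^T.
(* As [e] is the first basis vector, this determines the first row of [B], and [eBT] its first
   column. *)
have eB : e *m B = s *: e.
  by rewrite /B !mulmxA eH vA -scalemxAl -eK -mulmxA K1 mulmx1.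
have eBT : e *m B^T = s *: e.
  rewrite /B !trmx_mul trmxK !mulmxA eK uA -scalemxAl.
  by rewrite -eH -mulmxA H1 mulmx1.
have B_block : B = block_mx s%:M 0 0 (drsubmx B).
  move: eB eBT; rewrite -{1 2 3}[B]submxK tr_block_mx !mul_row_block.
  rewrite !mul1mx !mul0mx !addr0 scale_row_mx scaler0.
  move=> /eq_row_mx[-> ->] /eq_row_mx[_ dl0].
  by rewrite -[dlsubmx B]trmxK dl0 trmx0 scalemx1.
have [U [V [d [U1 V1 DB]]]] := IHn (drsubmx B).
pose bl W : 'M[R]_(1 + n) := block_mx (1%:M : 'M_1) 0 0 W.
have HT1 : H^T *m H = 1%:M by apply: mulmx1C.
have KT1 : K^T *m K = 1%:M by apply: mulmx1C.
(* The factorization of the lower right block extends to [B] by bordering with 1 and [s];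
   [A = H^T *m B *m K] then carries it back to [A]. *)
exists (H^T *m bl U), (K^T *m bl V), (row_mx s%:M d); split.
- rewrite trmx_mul trmxK mulmxA -[_ *m H *m _]mulmxA H1 mulmx1.
  exact: orthogonal_block.
- rewrite trmx_mul trmxK mulmxA -[_ *m K *m _]mulmxA K1 mulmx1.
  exact: orthogonal_block.
have -> : A = H^T *m B *m K.
  by rewrite /B !mulmxA HT1 mul1mx -mulmxA KT1 mulmx1.
clearbody B; rewrite trmx_mul trmxK !mulmxA.
congr (_ *m _); rewrite -!mulmxA; congr (_ *m _).
rewrite B_block diag_mx_row tr_block_mx !mulmx_block !trmx0 trmx1.
rewrite !mulmx0 !mul0mx !mulmx1 !mul1mx !addr0 !add0r ?mulmx0 ?addr0.
rewrite DB mulmxA; congr block_mx.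
by apply: mx11_inj; rewrite !mxE.
Qed.

Section Matricization.
Variables (R : comNzRingType) (I J : nat).
Local Notation pair_ord := ('I_I * 'I_J)%type.

(** The size is the cardinal of the type of index pairs, so that [enum_val] and [enum_rank] serve as
    the bijection between flat indices and pairs. *)
Definition mx_of_tensor (T : tensor4 R I J) : 'M[R]_#|{: pair_ord}| :=
  \matrix_(x, y)
    T ((enum_val x).1, (enum_val x).2, (enum_val y).1, (enum_val y).2).

Definition tensor_of_mx (M : 'M[R]_#|{: pair_ord}|) : tensor4 R I J :=
  [ffun p : 'I_I * 'I_J * 'I_I * 'I_J =>
     let: (i, j, k, l) := p in M (enum_rank (i, j)) (enum_rank (k, l))].

Lemma mx_of_tensorK : cancel mx_of_tensor tensor_of_mx.
Proof.
by move=> T; apply/ffunP=> -[[[i j] k] l]; rewrite ffunE mxE !enum_rankK.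
Qed.

Lemma tensor_of_mxM M N :
  tensor_of_mx (M *m N) = tensor_of_mx M *2 tensor_of_mx N.
Proof.
apply/ffunP=> -[[[i j] k] l]; rewrite !ffunE mxE pair_big /=.
(* The single flat index of the matrix product becomes the pair [(u, v)] contracted by the Einstein
   product. *)
rewrite (reindex enum_rank) /=; last exact/onW_bij/enum_rank_bij.
by apply: eq_bigr => -[u v] _; rewrite !ffunE.
Qed.

Lemma tensor_of_mx_tr M : tensor_of_mx M^T = (tensor_of_mx M)^T4.
Proof. by apply/ffunP=> -[[[i j] k] l]; rewrite !ffunE mxE. Qed.

Lemma tensor_of_mx1 : tensor_of_mx 1%:M = idtensor R I J.
Proof.
apply/ffunP=> -[[[i j] k] l]; rewrite !ffunE mxE.
by rewrite (inj_eq enum_rank_inj) xpair_eqE -natrM mulnb.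
Qed.

Lemma orthogonal_tensor_of_mx M :
  M^T *m M = 1%:M -> orthogonal_tensor (tensor_of_mx M).
Proof.
by move=> M1; rewrite /orthogonal_tensor -tensor_of_mx_tr -tensor_of_mxM M1
  tensor_of_mx1.
Qed.

Lemma diagonal_tensor_of_mx d : diagonal_tensor (tensor_of_mx (diag_mx d)).
Proof.
move=> i k j l neq; rewrite ffunE mxE (inj_eq enum_rank_inj).
by case: eqP => [[ik jl]|_]; [case: neq | rewrite mulr0n].
Qed.

Lemma einstein2_diagonalE (U D V : tensor4 R I J) i j i' j' :
    diagonal_tensor D ->
  (U *2 D *2 V^T4) (i, j, i', j') =
  \sum_(k < I) \sum_(l < J)
    (D (k, l, k, l) : R) * slice34 U k l i j * slice34 V k l i' j'.
Proof.
move=> diagD; rewrite ffunE; apply: eq_bigr => k _; apply: eq_bigr => l _.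
rewrite !ffunE !mxE; congr (_ * _).
(* In the inner contraction of [U] with [D], diagonality leaves only the term [(u, v) = (k, l)]. *)
rewrite pair_big (bigD1 (k, l)) //= big1 ?addr0 => [|[u v] /= neq].
  exact: mulrC.
rewrite diagD ?mulr0 // => -[uk vl]; by rewrite uk vl eqxx in neq.
Qed.

End Matricization.

Theorem theorem3p13 (R : realType) (I J : nat) (I_gt0 : (0 < I)%N)
    (J_gt0 : (0 < J)%N) (A : tensor4 R I J) :
  exists U V D : tensor4 R I J,
    [/\ orthogonal_tensor U, orthogonal_tensor V, diagonal_tensor D,
        A = U *2 D *2 V^T4 &
        A = \sum_(k < I) \sum_(l < J)
              D (k, l, k, l) *: outer_mx (slice34 U k l) (slice34 V k l)
        /\ (forall (i i' : 'I_I) (j j' : 'I_J),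
              A (i, j, i', j') =
              \sum_(k < I) \sum_(l < J)
                (D (k, l, k, l) : R) * slice34 U k l i j * slice34 V k l i' j')].
Proof.
have [U [V [d [U1 V1 svdA]]]] := svd_mx (mx_of_tensor A).
pose D := tensor_of_mx (diag_mx d).
have defA : A = tensor_of_mx U *2 D *2 (tensor_of_mx V)^T4.
  by rewrite -tensor_of_mx_tr -!tensor_of_mxM -svdA mx_of_tensorK.
have diagD : diagonal_tensor D := diagonal_tensor_of_mx d.
exists (tensor_of_mx U), (tensor_of_mx V), D.
split=> //; try exact: orthogonal_tensor_of_mx.
split; last by move=> i i' j j'; rewrite {1}defA einstein2_diagonalE.
(* Sums and scalings of tensors are pointwise, so the outer product expansion reduces to the
   entrywise formula. *)
apply/ffunP=> -[[[i j] i'] j']; rewrite {1}defA einstein2_diagonalE //.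
rewrite sum_ffunE; apply: eq_bigr => k _.
rewrite sum_ffunE; apply: eq_bigr => l _.
by rewrite !ffunE -mulrA.
Qed.
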